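(* Let $L\geq 1$ be an integer and choose an integer $m\geq 5$ such that $2^{m-5}\leq L<2^{m-4}$. Assume that $(a_\ell)_{\ell\in\mathbb Z}$ is a sequence such that $a_0=1$, $a_1,\ldots,a_{L-1}\in\{0,1\}$ and $a_\ell=0$ for $\ell\not\in[0,L)$. For integers $r\geq 1$ and $\ell\geq 0$ let $b^r_\ell=a_{\ell-r}-a_\ell$. There exist $\eta>0$ and $C$ such that for all integers $\lambda\geq 0$ and $r\geq 1$ satisfying $2m\leq\nu_2(r)\leq \lambda/4$, and for all sequences $(i_\ell)_{\ell\ge 0}$ of nonnegative integers satisfying $i_0=0$ and $0\leq i_{\ell+1}-i_\ell\leq 1$ for $0\leq \ell<L+r-1$, we have \[ \frac 1{2^\lambda}\sum_{0\le d<2^\lambda}\ \max_{0\le h<2^\lambda} \left| G_\lambda^{i,b^r}(h,d) \right|^2 \leq C2^{-\eta\lambda}. \]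
   Context: $\mathrm e(x)=\exp(2\pi i x)$; $\nu_2(r)$ is the exponent of $2$ in the prime factorization of $r$; $s(n)$ is the number of $1$s in the binary expansion of the nonnegative integer $n$; $s_\lambda(n)=s(\tilde n)$ where $0\le\tilde n<2^\lambda$ and $\tilde n\equiv n\bmod 2^\lambda$. For nonnegative integers $d$ and $\lambda$, sequences $i:\mathbb N\to\mathbb N$ and $b:\mathbb N\to\mathbb Z$ (with $\mathbb N=\{0,1,2,\ldots\}$), where $b$ has finite support, and $h\in\mathbb Z$, \[ G_\lambda^{i,b}(h,d) = \frac 1{2^\lambda} \sum_{0\le u<2^\lambda} \mathrm e\Biggl(\frac 12 \sum_{\ell\in\mathbb N} b_\ell\, s_\lambda\bigl(u+\ell d+i_\ell\bigr)-\frac{hu}{2^\lambda} \Biggr). \] *)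

(* Defs.v *)
From HB Require Import structures.
From mathcomp Require Export all_boot all_order all_algebra.
From mathcomp Require Export all_classical all_reals all_analysis.
From mathcomp.real_closed Require Export complex.

Set Implicit Arguments.
Unset Strict Implicit.
Unset Printing Implicit Defensive.

Import Order.TTheory GRing.Theory Num.Theory.

Local Open Scope ring_scope.

(* exp(2 pi i x), written with Euler's formula *)
Definition e {R : realType} (x : R) : R[i] :=
  Complex (cos (2 * pi * x)) (sin (2 * pi * x)).

(* Binary digits at positions j >= n vanish, since n < 2 ^ n. *)
Definition s (n : nat) : nat := (\sum_(j < n) odd (n %/ 2 ^ j))%N.

Definition s_trunc (lambda n : nat) : nat := s (n %% 2 ^ lambda)%N.

(* The sum over l is MathComp-Analysis' sum with finite support: it is the
   intended one whenever b has finite support (and is 0 by convention if the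
   summand has infinite support). *)
Definition G {R : realType} (lambda : nat) (i : nat -> nat) (b : nat -> int)
    (h : int) (d : nat) : R[i] :=
  (2 ^+ lambda)^-1 *
  \sum_(0 <= u < (2 ^ lambda)%N)
    e (2^-1 * (\sum_(l \in [set: nat]%classic)
                 b l * (s_trunc lambda (u + l * d + i l)%N)%:Z)%:~R
       - h%:~R * u%:R / 2 ^+ lambda : R).

Definition b_shift (a : int -> int) (r l : nat) : int :=
  a (l%:Z - r%:Z) - a l%:Z.

(* Main.v *)
Require Import Defs.
From mathcomp Require Import all_boot all_order all_algebra.
From mathcomp Require Import all_classical all_reals all_analysis.
From mathcomp.real_closed Require Import complex.
From mathcomp Require Import zify ring lra.

Import Order.TTheory GRing.Theory Num.Theory.
Local Open Scope ring_scope.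

(* Splitting off the lowest digits of u and d writes G_(k + lambda) as an average
   over v < 2^k of signed, rotated sums G_lambda with the same shape, where only
   the carries i_l <= l and i_(r+l) - w <= l + 1 (for l < L) matter.  A strict
   gain occurs when four values of v, in an affine square with sides 2^p and
   2^(2p), produce the same carries but signs with product -1; the phases e(-hv)
   cannot compensate this, whatever h is.  With p = m - 4 and k = 2p + 2 this
   happens as soon as w = 2^p mod 2^k and the next k digits of d are those of
   2^p: the upper parts of the arguments then meet the critical carry chain only
   at l = 0 in the unshifted half.  Writing r = 2^nu q with q odd, after nu digits
   d0 of d the carry is floor(w / 2^nu) + q d0, whose low nu digits are
   equidistributed, and the following nu digits of d give about nu / k independent
   chances of a gain.  Iterating over blocks of 2 nu digits yields about
   lambda / (2k) chances, each with probability 4^-k. *)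

(** * Splitting and parity of binary digit sums *)

Lemma s_widen (n N : nat) : (n <= N)%N ->
  s n = (\sum_(j < N) odd (n %/ 2 ^ j))%N.
Proof.
move=> nN; rewrite /s (big_ord_widen N (fun j => odd (n %/ 2 ^ j) : nat)) //.
rewrite [RHS](bigID (fun j : 'I_N => (j < n)%N)) /= [X in (_ + X)%N]big1 ?addn0//.
move=> j; rewrite -leqNgt => nj.
by rewrite divn_small // (leq_ltn_trans nj) // ltn_expl.
Qed.

Lemma s_half (n : nat) : s n = (odd n + s (n %/ 2))%N.
Proof.
rewrite (@s_widen n n.+1) // big_ord_recl /= expn0 divn1; congr (_ + _)%N.
rewrite (@s_widen (n %/ 2) n) ?leq_div //.
by apply: eq_bigr => j _; rewrite /bump /= add1n expnS divnMA.
Qed.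

Lemma s_cat (p n : nat) : s n = (s (n %% 2 ^ p) + s (n %/ 2 ^ p))%N.
Proof.
elim: p n => [|p IH] n; first by rewrite expn0 modn1 divn1 {2}/s big_ord0.
rewrite s_half [in RHS]s_half (IH (n %/ 2)%N) expnS -divnMA -addnA.
rewrite [in odd (n %% _)]odd_mod ?oddM //; congr (_ + (_ + _))%N.
by rewrite modn_divl mulnC.
Qed.

Lemma s_lowhigh (p lo hi : nat) : (lo < 2 ^ p)%N ->
  s (lo + 2 ^ p * hi) = (s lo + s hi)%N.
Proof.
move=> lop; have p0 : (0 < 2 ^ p)%N by rewrite expn_gt0.
rewrite (s_cat p) [(lo + _)%N]addnC [(2 ^ p * hi)%N]mulnC modnMDl.
rewrite modn_small // divnMDl //.
by rewrite divn_small // addn0.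
Qed.

Lemma s1 : s 1 = 1%N.
Proof. by rewrite /s big_ord_recl big_ord0 expn0 divn1. Qed.

Lemma s_pow2 (p : nat) : s (2 ^ p) = 1%N.
Proof.
by have := @s_lowhigh p 0 1; rewrite expn_gt0 muln1 add0n s1 /s big_ord0 => ->.
Qed.

Lemma s_trunc_cat (k lambda n : nat) :
  s_trunc (k + lambda) n = (s_trunc k n + s_trunc lambda (n %/ 2 ^ k))%N.
Proof.
rewrite /s_trunc (s_cat k) expnD modn_dvdm ?dvdn_mulr //; congr (_ + s _)%N.
by rewrite modn_divl mulnC.
Qed.

(** The square with base point [2 ^ (2 * p) - 2 ^ p] and sides [2 ^ p] and [2 ^ (2 * p)]. From the
    base point, a step [2 ^ p] carries through [p] ones. *)
Definition digit_offsets (p : nat) : seq nat :=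
  [:: 2 ^ (2 * p) - 2 ^ p; 2 ^ (2 * p); 2 * 2 ^ (2 * p) - 2 ^ p;
      2 * 2 ^ (2 * p)]%N.

(* With x = lo + 2^p t, the four arguments have upper parts t+Q-1, t+Q, t+2Q-1,
   t+2Q for Q = 2^p; unless t = 0, the digit sums cancel in pairs mod 2. *)
Lemma odd_digit_offsets (p lo t : nat) : (lo < 2 ^ p)%N -> (t < 2 ^ p)%N ->
  odd (\sum_(u <- digit_offsets p) s (u + (lo + t * 2 ^ p))) = (t == 0)%N.
Proof.
move=> lop tp; rewrite /digit_offsets !big_cons big_nil.
rewrite mul2n -addnn expnD.
set Q := (2 ^ p)%N in lop tp *.
have Q0 : (0 < Q)%N by lia.
have -> : (Q * Q - Q + (lo + t * Q) = lo + Q * (t + Q - 1))%N by nia.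
have -> : (Q * Q + (lo + t * Q) = lo + Q * (t + Q))%N by nia.
have -> : (2 * (Q * Q) - Q + (lo + t * Q) = lo + Q * (t + 2 * Q - 1))%N by nia.
have -> : (2 * (Q * Q) + (lo + t * Q) = lo + Q * (t + 2 * Q))%N by nia.
rewrite !s_lowhigh //.
have S1 x : (x < Q)%N -> s (x + Q) = (s x + 1)%N.
  by move=> xQ; rewrite -{1}[Q]muln1 s_lowhigh // s1.
have S2 x : (x < Q)%N -> s (x + 2 * Q) = (s x + 1)%N.
  by move=> xQ; rewrite [(2 * Q)%N]mulnC s_lowhigh // (s_pow2 1).
case: t tp => [|t] tp.
  rewrite !add0n /Q s_pow2 -expnS s_pow2 expnS -/Q.
  have -> : (2 * Q - 1 = Q - 1 + Q)%N by lia.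
  by rewrite S1; lia.
have -> : (t.+1 + Q - 1 = t + Q)%N by lia.
have -> : (t.+1 + 2 * Q - 1 = t + 2 * Q)%N by lia.
by rewrite !S1 ?S2 /=; lia.
Qed.

(** * Carries and phases when low digits are split off *)

Lemma modn_divn_low (N a x : nat) : (a < N)%N ->
  ((a + N * x) %% N = a)%N /\ ((a + N * x) %/ N = x)%N.
Proof.
move=> aN; have N0 : (0 < N)%N by lia.
by rewrite addnC mulnC modnMDl divnMDl // modn_small // divn_small // addn0.
Qed.

Lemma big_nat_mul_digits (V : nmodType) (a b : nat) (F : nat -> V) :
  \sum_(0 <= u < a * b) F u = \sum_(0 <= v < a) \sum_(0 <= w < b) F (v + a * w)%N.
Proof.
rewrite mulnC big_nat_mul exchange_big; apply: eq_bigr => w _.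
rewrite -{1}[(w * a)%N]add0n big_addn mulSn addnK.
by apply: eq_bigr => v _; rewrite [(a * w)%N]mulnC.
Qed.

(* [w] and [w + 1] are the only possible values of [i r] along a fixed [d]: the
   carries coming from different [u] differ by at most one. *)
Definition admissible (L r w : nat) (i : nat -> nat) : Prop :=
  forall l, (l < L)%N -> (i l <= l)%N /\ (w <= i (r + l)%N <= w + l.+1)%N.

Definition carry (k D v : nat) (i : nat -> nat) (l : nat) : nat :=
  ((v + l * D + i l) %/ 2 ^ k)%N.

(** Only the parity matters for the sign, so the negative contributions to [b_shift] are counted
    positively, which keeps the phase in [nat]. *)
Definition phase (L r : nat) (c : nat -> bool) (lambda : nat) (i : nat -> nat)
    (d u : nat) : nat :=
  (\sum_(l < L) c l * (s_trunc lambda (u + l * d + i l) +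
                       s_trunc lambda (u + (r + l) * d + i (r + l))))%N.

(** At [z = e (- (h / 2 ^ lambda))] this is [2 ^ lambda] times [G]. A free [z] survives splitting,
    which replaces it by [z ^+ (2 ^ k)]. *)
Definition thue_sum {R : realType} (L r : nat) (c : nat -> bool) (lambda : nat)
    (i : nat -> nat) (d : nat) (z : R[i]) : R[i] :=
  \sum_(0 <= u < 2 ^ lambda) (-1) ^+ phase L r c lambda i d u * z ^+ u.

(** As [v] and [D] are at most [2 ^ k - 1], [v + l * D + l] stays below [l.+1 * 2 ^ k]. One more
    unit in the shifted half reaches at most [l.+1 * 2 ^ k], whence the bound [w + l.+1]. *)
Lemma admissible_carry (L r w k D v : nat) (i : nat -> nat) :
  (v < 2 ^ k)%N -> (D < 2 ^ k)%N -> admissible L r w i ->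
  admissible L r ((w + r * D) %/ 2 ^ k)%N (carry k D v i).
Proof.
move=> vk Dk adm l lL; have [il /andP[ir1 ir2]] := adm l lL.
have p0 : (0 < 2 ^ k)%N by rewrite expn_gt0.
split; first by rewrite /carry -ltnS ltn_divLR //; nia.
rewrite /carry; apply/andP; split; first by apply: leq_div2r; nia.
rewrite [leqRHS]addnC -divnMDl // leq_div2r //; nia.
Qed.

Lemma phase_cat (L r : nat) (c : nat -> bool) (k lambda : nat)
    (i : nat -> nat) (D d v u : nat) :
  phase L r c (k + lambda) i (D + 2 ^ k * d) (v + 2 ^ k * u) =
  (phase L r c k i D v + phase L r c lambda (carry k D v i) d u)%N.
Proof.
have p0 : (0 < 2 ^ k)%N by rewrite expn_gt0.
have E x : s_trunc (k + lambda)
    (v + 2 ^ k * u + x * (D + 2 ^ k * d) + i x) =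
  (s_trunc k (v + x * D + i x) +
   s_trunc lambda (u + x * d + carry k D v i x))%N.
  have -> : (v + 2 ^ k * u + x * (D + 2 ^ k * d) + i x =
             (u + x * d) * 2 ^ k + (v + x * D + i x))%N by ring.
  by rewrite s_trunc_cat divnMDl // /s_trunc modnMDl.
rewrite /phase -big_split; apply: eq_bigr => l _.
by rewrite !E /=; ring.
Qed.

Lemma thue_sum_cat {R : realType} (L r : nat) (c : nat -> bool)
    (k lambda : nat) (i : nat -> nat) (D d : nat) (z : R[i]) :
  thue_sum L r c (k + lambda) i (D + 2 ^ k * d) z =
  \sum_(0 <= v < 2 ^ k) (-1) ^+ phase L r c k i D v * z ^+ v *
     thue_sum L r c lambda (carry k D v i) d (z ^+ (2 ^ k)).
Proof.
rewrite /thue_sum expnD big_nat_mul_digits; apply: eq_bigr => v _.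
rewrite mulr_sumr; apply: eq_bigr => u _.
by rewrite phase_cat exprD exprD exprM; ring.
Qed.

Lemma eq_thue_sum {R : realType} (L r : nat) (c : nat -> bool)
    (lambda : nat) (i i' : nat -> nat) (d : nat) (z : R[i]) :
  (forall l, (l < L)%N -> i l = i' l /\ i (r + l)%N = i' (r + l)%N) ->
  thue_sum L r c lambda i d z = thue_sum L r c lambda i' d z.
Proof.
move=> ii; apply: eq_bigr => u _; congr ((-1) ^+ _ * _).
by apply: eq_bigr => l _; have [-> ->] := ii l (ltn_ord l).
Qed.

(** * Estimates for the complex modulus *)

Section Normc.
Context {R : realType}.
Local Notation normc := (@Normc.normc R).

Lemma normc_ge0 (x : R[i]) : 0 <= normc x.
Proof. by case: x => a b; rewrite /Normc.normc sqrtr_ge0. Qed.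

Lemma normcD_le (x y : R[i]) : normc (x + y) <= normc x + normc y.
Proof. exact: (@le_normcD R x y). Qed.

Lemma normc_sum (I : Type) (t : seq I) (P : pred I) (F : I -> R[i]) :
  normc (\sum_(j <- t | P j) F j) <= \sum_(j <- t | P j) normc (F j).
Proof.
elim/big_rec2 : _ => [|j y x _ yx]; first by rewrite Normc.normc0.
by apply: le_trans (normcD_le _ _) _; rewrite lerD2l.
Qed.

Lemma normcX (x : R[i]) n : normc (x ^+ n) = normc x ^+ n.
Proof.
elim: n => [|n IH]; first by rewrite !expr0 Normc.normc1.
by rewrite !exprS Normc.normcM IH.
Qed.

Lemma normc_sign n : normc ((-1) ^+ n) = 1.
Proof.
by rewrite normcX (_ : normc (-1) = 1) ?expr1n // (@normcN R) Normc.normc1.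
Qed.

Lemma normc_parallelogram (x y : R[i]) :
  normc (x + y) ^+ 2 + normc (x - y) ^+ 2 = 2 * (normc x ^+ 2 + normc y ^+ 2).
Proof.
case: x => a b; case: y => a' b'; rewrite /Normc.normc /=.
by rewrite !sqr_sqrtr ?addr_ge0 ?sqr_ge0 //; ring.
Qed.

(* The modulus is at most |1 + s x| + |1 - s x| <= 2 sqrt 2 for a sign s. *)
Lemma normc_odd_signs (n1 n2 n3 n4 : nat) (x y : R[i]) :
  normc x = 1 -> normc y = 1 -> odd (n1 + n2 + n3 + n4) ->
  normc ((-1) ^+ n1 + (-1) ^+ n2 * x + (-1) ^+ n3 * y + (-1) ^+ n4 * (x * y))
    <= 3.
Proof.
move=> nx ny od.
have key (a b : R[i]) : normc a = 1 -> normc b = 1 ->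
    normc (a + b) + normc (a - b) <= 3.
  move=> na nb; have := normc_parallelogram a b; rewrite na nb !expr1n.
  move: (normc (a + b)) (normc (a - b)) => p q pq.
  by have := sqr_ge0 (p - q); nra.
(* As the product of the signs is -1, the second pair is, up to a unimodular factor, the first pair
   with its inner sign flipped. *)
have -> : (-1) ^+ n1 + (-1) ^+ n2 * x + (-1) ^+ n3 * y + (-1) ^+ n4 * (x * y) =
    ((-1) ^+ n1 + (-1) ^+ n2 * x) +
    y * (-1) ^+ (n1 + n3) * ((-1) ^+ n1 - (-1) ^+ n2 * x) :> R[i].
  move: od; rewrite -!(signr_odd _ n1) -!(signr_odd _ n2) -!(signr_odd _ n3).
  rewrite -!(signr_odd _ n4) -!(signr_odd _ (n1 + n3)) !oddD.
  by case: (odd n1); case: (odd n2); case: (odd n3); case: (odd n4) => //= _;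
    rewrite ?expr0 ?expr1; ring.
apply: le_trans (normcD_le _ _) _.
rewrite !Normc.normcM ny normc_sign !mul1r; apply: key; rewrite ?normc_sign //.
by rewrite Normc.normcM normc_sign mul1r.
Qed.

Lemma normc_sum_subseq (n : nat) (t : seq nat) (F : nat -> R[i]) (B : R) :
  uniq t -> {in t, forall u, (u < n)%N} ->
  (forall u, (u < n)%N -> normc (F u) <= B) ->
  normc (\sum_(0 <= u < n) F u) <=
    normc (\sum_(u <- t) F u) + (n - size t)%N%:R * B.
Proof.
move=> ut tn FB.
set t' := [seq u <- index_iota 0 n | u \notin t].
have pt : perm_eq (index_iota 0 n) (t ++ t').
  apply: uniq_perm; rewrite ?iota_uniq //.
    rewrite cat_uniq ut filter_uniq ?iota_uniq //= andbT.
    by apply/hasPn => u; rewrite mem_filter => /andP[].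
  move=> u; rewrite mem_cat mem_filter mem_index_iota /=.
  by case: (boolP (u \in t)) => [/tn ->|].
rewrite (perm_big _ pt) big_cat /=.
apply: le_trans (normcD_le _ _) _; rewrite lerD2l.
apply: le_trans (normc_sum _ _ _ _) _.
have -> : (n - size t)%N = size t'.
  move/perm_size: pt; rewrite size_cat /index_iota size_iota subn0 => ->.
  by rewrite addKn.
have -> : (size t')%:R * B = \sum_(u <- t') B.
  by rewrite big_const_seq count_predT iter_addr_0 mulr_natl.
rewrite [X in X <= _]big_seq [X in _ <= X]big_seq; apply: ler_sum => u.
by rewrite mem_filter mem_index_iota => /andP[_ /FB].
Qed.

End Normc.

(** * Bounds that are stable under splitting *)

(** Uniformity in [z] covers all [h] at once; uniformity in [i] leaves [w] as the only memory of the
    carries. *)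
Definition thue_bound {R : realType} (L r : nat) (c : nat -> bool)
    (lambda w d : nat) (B : R) : Prop :=
  forall (i : nat -> nat) (z : R[i]), admissible L r w i ->
    Normc.normc z = 1 ->
    Normc.normc (thue_sum L r c lambda i d z) <= 2 ^+ lambda * B.

Lemma thue_bound1 {R : realType} (L r : nat) (c : nat -> bool)
    (lambda w d : nat) : thue_bound L r c lambda w d (1 : R).
Proof.
move=> i z _ nz; apply: le_trans (normc_sum _ _ _ _) _.
rewrite (eq_bigr (fun=> 1)) => [|u _].
  by rewrite sumr_const_nat subn0 mulr1 natrX.
by rewrite Normc.normcM normc_sign normcX nz expr1n mulr1.
Qed.

Lemma normc_thue_term {R : realType} (n u : nat) (z T : R[i]) :
  Normc.normc z = 1 ->
  Normc.normc ((-1) ^+ n * z ^+ u * T) = Normc.normc T.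
Proof. by move=> nz; rewrite !Normc.normcM normc_sign normcX nz expr1n !mul1r. Qed.

(** Triangle inequality over the low digits [v]: whatever [v] is, the new carries are admissible for
    the same new [w]. *)
Lemma thue_bound_cat {R : realType} (L r : nat) (c : nat -> bool)
    (k lambda w D d : nat) (B : R) :
  (D < 2 ^ k)%N -> thue_bound L r c lambda ((w + r * D) %/ 2 ^ k) d B ->
  thue_bound L r c (k + lambda) w (D + 2 ^ k * d) B.
Proof.
move=> Dk HB i z adm nz; rewrite thue_sum_cat.
apply: le_trans (normc_sum _ _ _ _) _.
have -> : 2 ^+ (k + lambda) * B = \sum_(0 <= v < 2 ^ k) 2 ^+ lambda * B.
  by rewrite sumr_const_nat subn0 -[RHS]mulr_natl natrX exprD mulrA.
rewrite [X in X <= _]big_seq [X in _ <= X]big_seq; apply: ler_sum => v.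
rewrite mem_index_iota /= => vk; rewrite normc_thue_term //; apply: HB.
  exact: admissible_carry.
by rewrite normcX nz expr1n.
Qed.

(** * The gain from one window of [k] digits *)

Lemma digit_offsets_le (p u : nat) :
  u \in digit_offsets p -> (u <= 2 * (2 ^ p * 2 ^ p))%N.
Proof.
have E : (2 ^ (2 * p) = 2 ^ p * 2 ^ p)%N by rewrite mul2n -addnn expnD.
by rewrite !inE !E => /or4P[] /eqP ->; lia.
Qed.

Section Gain.
Variables (L r p k w : nat) (c : nat -> bool) (i : nat -> nat).
Hypotheses (L0 : (0 < L)%N) (Lp : (L < 2 ^ p)%N) (c0 : c 0%N).
Hypotheses (kE : k = (2 * p + 2)%N) (kr : (2 ^ k %| r)%N).
Hypotheses (wE : (w %% 2 ^ k = 2 ^ p)%N) (adm : admissible L r w i).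

Let two_k : (2 ^ k = 4 * (2 ^ p * 2 ^ p))%N.
Proof. by rewrite kE expnD mul2n -addnn expnD mulnC. Qed.

(** The low part [2 ^ p] of [w] turns [l] into [l.+1], so the shifted half never meets the case
    [t = 0] of [odd_digit_offsets]. Here [j] is the excess of [i (r + l)] over [w], at most [L]. *)
Lemma admissible_high (l : nat) : (l < L)%N ->
  exists2 j, (j < 2 ^ p)%N & forall u, u \in digit_offsets p ->
    (u + (j + l.+1 * 2 ^ p) < 2 ^ k)%N /\
    (u + (r + l) * 2 ^ p + i (r + l) =
     (r %/ 2 ^ k * 2 ^ p + w %/ 2 ^ k) * 2 ^ k + (u + (j + l.+1 * 2 ^ p)))%N.
Proof.
move=> lL; have [_ /andP[w1 w2]] := adm l lL.
exists (i (r + l) - w)%N; first by lia.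
move=> u /digit_offsets_le; move: two_k (divn_eq w (2 ^ k)) (divnK kr).
rewrite wE; move: (w %/ _)%N (r %/ _)%N => W r' kQ wW rr uu.
have LQ : (l.+1 * 2 ^ p <= (2 ^ p - 1) * 2 ^ p)%N by rewrite leq_mul2r; lia.
split; first by nia.
have rQ : (r * 2 ^ p = r' * 2 ^ p * 2 ^ k)%N by rewrite -rr mulnAC.
by rewrite mulnDl rQ; lia.
Qed.

Lemma admissible_low (l u : nat) : (l < L)%N -> u \in digit_offsets p ->
  (i l < 2 ^ p)%N /\ (u + l * 2 ^ p + i l < 2 ^ k)%N.
Proof.
move=> lL /digit_offsets_le uu; have [il _] := adm l lL.
have LQ : (l.+1 * 2 ^ p <= (2 ^ p - 1) * 2 ^ p)%N by rewrite leq_mul2r; lia.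
by split; [lia | rewrite two_k; nia].
Qed.

(** The room in [2 ^ k = 4 * 2 ^ (2 * p)] absorbs every offset without overflow. *)
Lemma carry_digit_offsets (u : nat) : u \in digit_offsets p ->
  forall l, (l < L)%N ->
    carry k (2 ^ p) u i l = carry k (2 ^ p) (2 ^ (2 * p)) i l /\
    carry k (2 ^ p) u i (r + l) = carry k (2 ^ p) (2 ^ (2 * p)) i (r + l).
Proof.
move=> uo l lL; have k0 : (0 < 2 ^ k)%N by rewrite expn_gt0.
have u0 : (2 ^ (2 * p))%N \in digit_offsets p by rewrite !inE eqxx orbT.
rewrite /carry; split.
  have [_ h1] := admissible_low l u lL uo.
  by have [_ h2] := admissible_low l _ lL u0; rewrite !divn_small.
have [j _ H] := admissible_high l lL.
have [h1 ->] := H _ uo; have [h2 ->] := H _ u0.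
by rewrite !divnMDl // (divn_small h1) (divn_small h2).
Qed.

Lemma odd_phase_digit_offsets :
  odd (\sum_(u <- digit_offsets p) phase L r c k i (2 ^ p) u).
Proof.
rewrite exchange_big /= (big_morph odd oddD (erefl _)).
(* The unshifted half has [t = l], the shifted half [t = l.+1], so only [l = 0] contributes an odd
   amount. *)
rewrite (eq_bigr (fun l : 'I_L => (l == 0 :> nat) && c l)) => [|l _].
  move: L0; case: (L) => // L' _.
  by rewrite big_ord_recl /= c0 big1.
rewrite -big_distrr /= oddM big_split oddD /= oddb andbC; congr (_ && _).
have lL := ltn_ord l; have [j jp H] := admissible_high l lL.
rewrite [X in odd X](eq_big_seq (fun u => s (u + (i l + l * 2 ^ p))%N)); last first.
  move=> u uo; have [_ h] := admissible_low l u lL uo.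
  by rewrite /s_trunc modn_small // addnAC addnA.
rewrite odd_digit_offsets; first last.
- by lia.
- by have [] := admissible_low l (2 ^ (2 * p)) lL; rewrite ?inE ?eqxx ?orbT.
rewrite [X in _ (+) odd X](eq_big_seq
  (fun u => s (u + (j + l.+1 * 2 ^ p))%N)); last first.
  by move=> u uo; have [h ->] := H u uo; rewrite /s_trunc modnMDl modn_small.
by rewrite odd_digit_offsets // ?addbF //; lia.
Qed.

Lemma normc_digit_offsets {R : realType} (z T : R[i]) :
  Normc.normc z = 1 ->
  Normc.normc (\sum_(u <- digit_offsets p)
     (-1) ^+ phase L r c k i (2 ^ p) u * z ^+ u * T) <= 3 * Normc.normc T.
Proof.
move=> nz; move: odd_phase_digit_offsets; rewrite -mulr_suml Normc.normcM.
rewrite /digit_offsets !big_cons !big_nil /=.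
have E : (2 ^ (2 * p) = 2 ^ p * 2 ^ p)%N by rewrite mul2n -addnn expnD.
have p0 : (0 < 2 ^ p)%N by rewrite expn_gt0.
(* With [2 ^ (2 * p) = u1 + 2 ^ p], the four powers are [z ^+ u1] times 1, [x], [y], [x * y], as in
   [normc_odd_signs]. *)
set u1 := (2 ^ (2 * p) - 2 ^ p)%N.
have -> : (2 ^ (2 * p) = u1 + 2 ^ p)%N by rewrite /u1 E; nia.
have -> : (2 * (u1 + 2 ^ p) - 2 ^ p = u1 + (u1 + 2 ^ p))%N by lia.
have -> : (2 * (u1 + 2 ^ p) = u1 + (2 ^ p + (u1 + 2 ^ p)))%N by lia.
move: (phase _ _ _ _ _ _ _) (phase _ _ _ _ _ _ _) => n2 n1.
move: (phase _ _ _ _ _ _ _) (phase _ _ _ _ _ _ _) => n4 n3.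
rewrite !addr0 addn0 !addnA => od.
apply: ler_wpM2r; first exact: normc_ge0.
have := @normc_odd_signs R n1 n2 n3 n4 (z ^+ (2 ^ p)) (z ^+ (u1 + 2 ^ p)).
rewrite !normcX nz !expr1n => /(_ erefl erefl od).
set x := z ^+ (2 ^ p); set y := z ^+ (u1 + 2 ^ p).
rewrite -(mul1r (Normc.normc _)) -(expr1n _ u1) -nz -normcX -Normc.normcM.
congr (Normc.normc _ <= _).
by rewrite !exprD -/x /y exprD -/x; ring.
Qed.

End Gain.

(* The four offsets [u] lead to the same carries, hence to the same remaining
   sum, but with signs whose product is [-1]. *)
Lemma thue_bound_gain {R : realType} (L r p k w lambda d : nat)
    (c : nat -> bool) (B : R) :
  (0 < L)%N -> (L < 2 ^ p)%N -> c 0%N -> k = (2 * p + 2)%N ->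
  (2 ^ k %| r)%N -> (w %% 2 ^ k = 2 ^ p)%N ->
  thue_bound L r c lambda ((w + r * 2 ^ p) %/ 2 ^ k) d B ->
  thue_bound L r c (k + lambda) w (2 ^ p + 2 ^ k * d) ((1 - (2 ^+ k)^-1) * B).
Proof.
move=> L0 Lp c0 kE kr wE HB i z adm nz; rewrite thue_sum_cat.
have p1 : (1 < 2 ^ p)%N by lia.
have E : (2 ^ (2 * p) = 2 ^ p * 2 ^ p)%N by rewrite mul2n -addnn expnD.
have kQ : (2 ^ k = 4 * (2 ^ p * 2 ^ p))%N by rewrite kE expnD E mulnC.
have TB v : (v < 2 ^ k)%N -> Normc.normc
    (thue_sum L r c lambda (carry k (2 ^ p) v i) d (z ^+ (2 ^ k))) <=
    2 ^+ lambda * B.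
  move=> vk; apply: HB; last by rewrite normcX nz expr1n.
  by apply: admissible_carry => //; rewrite kQ; nia.
apply: le_trans (@normc_sum_subseq R _ (digit_offsets p) _ (2 ^+ lambda * B) _ _ _) _.
- rewrite /digit_offsets E /= !inE; nia.
- by move=> u /digit_offsets_le; rewrite kQ; nia.
- by move=> u uk; rewrite normc_thue_term //; apply: TB.
set T := thue_sum L r c lambda (carry k (2 ^ p) (2 ^ (2 * p)) i) d (z ^+ (2 ^ k)).
rewrite (eq_big_seq (fun u => (-1) ^+ phase L r c k i (2 ^ p) u * z ^+ u * T)).
  (* Four terms count as 3, so the total weight drops from [2 ^ k] to [2 ^ k - 1]. *)
  apply: (@le_trans _ _ (3 * (2 ^+ lambda * B) + (2 ^ k - 4)%N%:R * (2 ^+ lambda * B))).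
    rewrite lerD2r.
    apply: le_trans (normc_digit_offsets _ _ _ _ w _ _ _ _ _ _ _ _ _ _ _ nz) _ => //.
    by rewrite ler_wpM2l //; apply: TB; rewrite E kQ; nia.
  rewrite natrB; last by rewrite kQ; nia.
  rewrite natrX exprD; have : (2 ^+ k : R) != 0 by rewrite expf_neq0.
  by move: (2 ^+ k) => X X0; rewrite le_eqVlt; apply/orP; left; apply/eqP; field.
move=> u uo; congr (_ * _); apply: eq_thue_sum.
exact: (carry_digit_offsets L r p k w c i).
Qed.

(** * Accumulated gains and their averages *)

(** Here [x] is the carry and [y] holds digits of [d], read in parallel. *)
Fixpoint gain {R : realType} (p k J x y : nat) : R :=
  if J is J'.+1 then
    (1 - (x %% 2 ^ k == 2 ^ p)%N%:R * (y %% 2 ^ k == 2 ^ p)%N%:R * (2 ^+ k)^-1)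
    * gain p k J' (x %/ 2 ^ k)%N (y %/ 2 ^ k)%N
  else 1.

Lemma eqmod_div (a b m n : nat) : a = b %[mod n * m] -> a %/ m = b %/ m %[mod n].
Proof. by rewrite !modn_divl => ->. Qed.

Lemma eq_gain {R : realType} (p k J x x' y : nat) :
  x = x' %[mod 2 ^ (k * J)] -> gain p k J x y = gain p k J x' y :> R.
Proof.
elim: J x x' y => //= J IH x x' y; rewrite mulnS expnD => xx.
have -> : x = x' %[mod 2 ^ k].
  by rewrite -(modn_dvdm x (dvdn_mulr (2 ^ (k * J)) (dvdnn _))) xx modn_dvdm ?dvdn_mulr.
by rewrite (IH _ (x' %/ 2 ^ k)%N) //; apply: eqmod_div; rewrite mulnC.
Qed.

(* As [2 ^ (k * J)] divides [r], the carries from [r * y] do not disturb the low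
   digits of [w], so the favourable windows are read off [w] itself. *)
Lemma thue_bound_gains {R : realType} (L r p k J n w y lambda d : nat)
    (c : nat -> bool) (B : R) :
  (0 < L)%N -> (L < 2 ^ p)%N -> c 0%N -> k = (2 * p + 2)%N ->
  (2 ^ (k * J) %| r)%N -> (k * J <= n)%N -> (y < 2 ^ n)%N ->
  thue_bound L r c lambda ((w + r * y) %/ 2 ^ n) d B ->
  thue_bound L r c (n + lambda) w (y + 2 ^ n * d) (gain p k J w y * B).
Proof.
move=> L0 Lp c0 kE; elim: J n w y => [|J IH] n w y.
  by move=> _ _ yn HB; rewrite mul1r; apply: thue_bound_cat.
rewrite mulnS expnD => kr kn yn HB.
have k0 : (0 < 2 ^ k)%N by rewrite expn_gt0.
have [n' nE] : exists n', n = (k + n')%N by exists (n - k)%N; lia.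
move: kn yn HB; rewrite {n}nE leq_add2l !expnD => kn yn HB.
set D := (y %% 2 ^ k)%N; set y' := (y %/ 2 ^ k)%N.
have Dk : (D < 2 ^ k)%N by rewrite ltn_mod.
have yE : y = (D + 2 ^ k * y')%N by rewrite [LHS](divn_eq y (2 ^ k)) addnC mulnC.
have y'n : (y' < 2 ^ n')%N by rewrite /y' ltn_divLR // mulnC.
have -> : (y + 2 ^ k * 2 ^ n' * d = D + 2 ^ k * (y' + 2 ^ n' * d))%N.
  by rewrite {1}yE; ring.
have {}HB : thue_bound L r c lambda
    (((w + r * D) %/ 2 ^ k + r * y') %/ 2 ^ n')%N d B.
  rewrite addnC -divnMDl // -divnMA.
  by rewrite (_ : r * y' * 2 ^ k + (w + r * D) = w + r * y)%N // yE; ring.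
have {}HB := IH n' ((w + r * D) %/ 2 ^ k)%N y'
  (dvdn_trans (dvdn_mull _ (dvdnn _)) kr) kn y'n HB.
rewrite (_ : gain p k J _ y' = gain p k J (w %/ 2 ^ k)%N y') in HB; last first.
  apply: eq_gain; apply: eqmod_div; rewrite [(2 ^ (k * J) * _)%N]mulnC.
  by move/dvdnP: kr => [q ->]; rewrite mulnAC addnC modnMDl.
rewrite -addnA /= -[X in thue_bound _ _ _ _ _ _ X]mulrA.
have [wQ|_] := eqVneq (w %% 2 ^ k)%N (2 ^ p)%N; last first.
  by rewrite !mul0r subr0 mul1r; apply: thue_bound_cat.
have [yQ|_] := eqVneq (y %% 2 ^ k)%N (2 ^ p)%N; last first.
  by rewrite mulr0 mul0r subr0 mul1r; apply: thue_bound_cat.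
rewrite !mul1r; move: HB; rewrite /D yQ => HB.
by apply: thue_bound_gain => //; apply: dvdn_trans kr; apply: dvdn_mulr.
Qed.

Lemma sum_nat_eq {R : pzSemiRingType} (Q N : nat) : (Q < N)%N ->
  \sum_(0 <= a < N) (a == Q)%:R = 1 :> R.
Proof.
move=> QN; rewrite (bigD1_seq Q) ?mem_index_iota ?iota_uniq //= eqxx big1 ?addr0//.
by move=> a /negbTE ->.
Qed.

(** The mean factor of one window: a favourable pair has probability [4 ^ - k] and saves
    [2 ^ - k]. *)
Definition gain_ratio {R : realType} (k : nat) : R := 1 - (2 ^+ (3 * k))^-1.

Lemma sum_gain1 {R : realType} (p k : nat) : (p < k)%N ->
  \sum_(0 <= a < 2 ^ k) \sum_(0 <= b < 2 ^ k)
    (1 - (a == 2 ^ p)%N%:R * (b == 2 ^ p)%N%:R * (2 ^+ k)^-1) =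
  2 ^+ k * 2 ^+ k * gain_ratio k :> R.
Proof.
move=> pk; have Q : (2 ^ p < 2 ^ k)%N by rewrite ltn_exp2l.
under eq_bigr => a _.
  rewrite sumrB sumr_const_nat subn0 -mulr_suml -mulr_sumr sum_nat_eq // mulr1.
  over.
rewrite sumrB sumr_const_nat subn0 -mulr_suml sum_nat_eq // mul1r.
rewrite /gain_ratio -mulrnA natrM natrX.
rewrite mulnC exprM; have : (2 ^+ k : R) != 0 by rewrite expf_neq0.
by move: (2 ^+ k) => X X0; field.
Qed.

(** Distinct windows use disjoint digits of [x] and [y], so the average factors. *)
Lemma sum_gain {R : realType} (p k J n : nat) : (p < k)%N -> (k * J <= n)%N ->
  \sum_(0 <= x < 2 ^ n) \sum_(0 <= y < 2 ^ n) gain p k J x y =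
  2 ^+ n * 2 ^+ n * gain_ratio k ^+ J :> R.
Proof.
move=> pk; elim: J n => [|J IH] n kn.
  under eq_bigr do rewrite sumr_const_nat subn0.
  by rewrite sumr_const_nat subn0 -mulrnA mulr1 natrM natrX.
have [n' nE] : exists n', n = (k + n')%N by exists (n - k)%N; lia.
move: kn; rewrite {n}nE mulnS leq_add2l => kn.
rewrite expnD big_nat_mul_digits.
transitivity (\sum_(0 <= a < 2 ^ k) \sum_(0 <= b < 2 ^ k)
    (1 - (a == 2 ^ p)%N%:R * (b == 2 ^ p)%N%:R * (2 ^+ k)^-1) *
    (\sum_(0 <= x < 2 ^ n') \sum_(0 <= y < 2 ^ n') gain p k J x y) : R).
  apply: eq_big_nat => a /andP[_ ak].
  under eq_bigr do rewrite big_nat_mul_digits.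
  rewrite exchange_big; apply: eq_big_nat => b /andP[_ bk].
  rewrite mulr_sumr; apply: eq_bigr => x _.
  rewrite mulr_sumr; apply: eq_bigr => y _ /=.
  by have [-> ->] := modn_divn_low _ _ x ak; have [-> ->] := modn_divn_low _ _ y bk.
rewrite IH //; under eq_bigr do rewrite -mulr_suml.
by rewrite -mulr_suml sum_gain1 // !exprD exprS; ring.
Qed.

(** * Iteration over blocks of [nu + nu] digits *)

(** Multiplication by [q] is invertible modulo [N], so the affine map permutes residues. For
    [N = 2 ^ nu] this equidistributes the low digits of the carry. *)
Lemma sum_affine_mod (V : nmodType) (N q a : nat) (F : nat -> V) :
  (0 < N)%N -> coprime N q ->
  \sum_(0 <= x < N) F ((a + q * x) %% N)%N = \sum_(0 <= x < N) F x.
Proof.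
move=> N0 co; rewrite !big_mkord.
pose f (x : 'I_N) : 'I_N := Ordinal (ltn_pmod (a + q * x) N0).
rewrite [RHS](reindex_inj (h := f)) // => x y /(congr1 val) /= /eqP.
rewrite eqn_modDl; wlog yx : x y / (y <= x)%N.
  by move=> H; case/orP: (leq_total y x) => /H // H'; rewrite eq_sym => /H' ->.
rewrite eqn_mod_dvd ?leq_mul2l ?yx ?orbT // -mulnBr Gauss_dvdr // => dv.
apply/val_inj/eqP; rewrite eqn_leq yx andbT -subn_eq0.
case: posnP dv => // p0 /(dvdn_leq p0).
by rewrite leqNgt (leq_ltn_trans (leq_subr _ _)) // ltn_ord.
Qed.

(* The first [nu] digits of [d] randomize the low digits of the carry [w1]; the
   next [nu] digits, independent of these, are tested against it. *)
Fixpoint block_bound {R : realType} (p k r nu J n w d : nat) : R :=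
  if n is n'.+1 then
    let w1 := ((w + r * (d %% 2 ^ nu)) %/ 2 ^ nu)%N in
    let d1 := (d %/ 2 ^ nu)%N in
    let w2 := ((w1 + r * (d1 %% 2 ^ nu)) %/ 2 ^ nu)%N in
    gain p k J w1 (d1 %% 2 ^ nu)%N *
    block_bound p k r nu J n' w2 (d1 %/ 2 ^ nu)%N
  else 1.

(** The first half of a block passes through [thue_bound_cat], the second through
    [thue_bound_gains]; the last [mu] digits get the trivial bound. *)
Lemma thue_bound_blocks {R : realType} (L r p k nu J mu n w d : nat)
    (c : nat -> bool) :
  (0 < L)%N -> (L < 2 ^ p)%N -> c 0%N -> k = (2 * p + 2)%N ->
  (2 ^ nu %| r)%N -> (k * J <= nu)%N ->
  thue_bound L r c (n * (nu + nu) + mu) w d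
    (block_bound p k r nu J n w d : R).
Proof.
move=> L0 Lp c0 kE nur kJ; elim: n w d => [|n IH] w d /=; first exact: thue_bound1.
have p0 : (0 < 2 ^ nu)%N by rewrite expn_gt0.
have split_digits x : x = (x %% 2 ^ nu + 2 ^ nu * (x %/ 2 ^ nu))%N.
  by rewrite [LHS](divn_eq x (2 ^ nu)) addnC [(2 ^ nu * _)%N]mulnC.
rewrite mulSn -!addnA {1}(split_digits d).
apply: (thue_bound_cat L r c nu); first by rewrite ltn_mod.
rewrite {1}(split_digits (d %/ 2 ^ nu)%N).
apply: (thue_bound_gains L r p k J nu) => //.
  by apply: dvdn_trans nur; rewrite dvdn_exp2l.
by rewrite ltn_mod.
Qed.

(** The later blocks have the same average from any starting [w], so induction removes them with the
    current digits fixed; [sum_affine_mod] and [sum_gain] then average the current block. *)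
Lemma sum_block_bound {R : realType} (p k q nu J mu n w : nat) :
  (p < k)%N -> odd q -> (k * J <= nu)%N ->
  \sum_(0 <= d < 2 ^ (n * (nu + nu) + mu))
    block_bound p k (2 ^ nu * q) nu J n w d =
  2 ^+ (n * (nu + nu) + mu) * gain_ratio k ^+ (n * J) :> R.
Proof.
move=> pk oq kJ; have p0 : (0 < 2 ^ nu)%N by rewrite expn_gt0.
elim: n w => [|n IH] w.
  by rewrite sumr_const_nat subn0 natrX expr0 mulr1.
rewrite mulSn -!addnA !expnD big_nat_mul_digits -!expnD.
transitivity (\sum_(0 <= x < 2 ^ nu) \sum_(0 <= y < 2 ^ nu) gain p k J x y *
    (2 ^+ (n * (nu + nu) + mu) * gain_ratio k ^+ (n * J)) : R).
  rewrite -[RHS](@sum_affine_mod _ _ q (w %/ 2 ^ nu)) ?coprimeXl ?coprime2n //.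
  apply: eq_big_nat => d0 /andP[_ d0k]; rewrite expnD big_nat_mul_digits.
  apply: eq_big_nat => d1 /andP[_ d1k].
  rewrite -(IH (((w + 2 ^ nu * q * d0) %/ 2 ^ nu + 2 ^ nu * q * d1)
                %/ 2 ^ nu)%N) mulr_sumr.
  apply: eq_bigr => d _ /=.
  have [-> ->] := modn_divn_low _ _ (d1 + 2 ^ nu * d)%N d0k.
  have [-> ->] := modn_divn_low _ _ d d1k.
  (* Only the low [k * J <= nu] digits are read, so the carry may be reduced modulo [2 ^ nu]. *)
  congr (_ * _); apply: eq_gain.
  rewrite -(modn_dvdm (_ %% _) (dvdn_exp2l 2 kJ)) modn_mod modn_dvdm ?dvdn_exp2l //.
  by rewrite addnC -mulnA mulnC divnMDl // addnC.
under eq_bigr do rewrite -mulr_suml.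
by rewrite -mulr_suml sum_gain // mulSn !exprD; ring.
Qed.

(** * Exponentials and the passage from [G] to [thue_sum] *)

Section Exponential.
Context {R : realType}.

Lemma eD (x y : R) : e (x + y) = e x * e y.
Proof.
rewrite /e mulrDr cosD sinD; apply/eqP; rewrite eq_complex /= eqxx /=.
by rewrite addrC.
Qed.

Lemma e0 : e (0 : R) = 1.
Proof. by rewrite /e mulr0 cos0 sin0. Qed.

Lemma eMn (x : R) (n : nat) : e (x * n%:R) = e x ^+ n.
Proof.
elim: n => [|n IH]; first by rewrite mulr0 e0 expr0.
by rewrite -addn1 natrD mulrDr mulr1 eD IH exprD expr1.
Qed.

Lemma e_half : e (2^-1 : R) = -1.
Proof.
rewrite /e (_ : 2 * pi * 2^-1 = pi); last by field.
by rewrite cospi sinpi; apply/eqP; rewrite eq_complex /= oppr0 !eqxx.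
Qed.

Lemma normc_e (x : R) : Normc.normc (e x) = 1.
Proof. by rewrite /e /Normc.normc cos2Dsin2 sqrtr1. Qed.

(** Holds because [e] equals -1 at both 1/2 and -1/2. *)
Lemma e_half_subz (Y Z : nat) :
  e (2^-1 * (Y%:Z - Z%:Z)%:~R : R) = (-1) ^+ (Y + Z).
Proof.
have eN : e (- 2^-1 : R) = -1.
  have := eD (- 2^-1) (2^-1); rewrite addNr e0 e_half mulrN1 => E.
  by rewrite -[LHS]opprK -E.
rewrite rmorphB /= -!pmulrn mulrBr -mulNr eD !eMn e_half eN exprD.
by [].
Qed.

End Exponential.

Lemma fsum_b_shift (a : int -> int) (L r : nat) (F : nat -> nat) :
  (forall l : nat, (l < L)%N -> a l = (a l == 1)%:Z) ->
  (forall l : int, ~~ (0 <= l < L%:Z) -> a l = 0) ->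
  \sum_(l \in [set: nat]%classic) b_shift a r l * (F l)%:Z =
  (\sum_(l < L) (a l == 1%Z) * F (r + l))%N%:Z -
  (\sum_(l < L) (a l == 1%Z) * F l)%N%:Z.
Proof.
move=> a01 aout.
rewrite (fsbigE (iota 0 (r + L))) ?iota_uniq //; last first.
  move=> l _; rewrite mem_iota add0n /= -leqNgt => lrL.
  by rewrite /b_shift !aout ?subrr ?mul0r //; lia.
under eq_bigl do rewrite in_setT.
rewrite -{1}[(r + L)%N]subn0 -/(index_iota 0 (r + L)).
under eq_bigr do rewrite /b_shift mulrBl.
rewrite sumrB !(big_morph Posz PoszD (erefl _)); congr (_ - _).
  rewrite (big_cat_nat (n := r)) ?leq_addr //= big_nat big1 ?add0r; last first.
    by move=> l /andP[_ lr]; rewrite aout ?mul0r //; lia.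
  rewrite -{1}[r]add0n big_addn addKn big_mkord; apply: eq_bigr => l _.
  by rewrite addnC PoszD addrAC subrr add0r {1}a01 // PoszM.
rewrite addnC (big_cat_nat (n := L)) ?leq_addr //= [X in _ + X]big_nat.
rewrite [X in _ + X]big1 ?addr0; last first.
  by move=> l /andP[lL _]; rewrite aout ?mul0r //; lia.
by rewrite big_mkord; apply: eq_bigr => l _; rewrite {1}a01 // PoszM.
Qed.

Lemma G_thue_sum {R : realType} (a : int -> int) (L r lambda d : nat)
    (i : nat -> nat) (h : int) :
  (forall l : nat, (l < L)%N -> a l = (a l == 1)%:Z) ->
  (forall l : int, ~~ (0 <= l < L%:Z) -> a l = 0) ->
  G lambda i (b_shift a r) h d = (2 ^+ lambda)^-1 *
    thue_sum L r (fun l => a l == 1) lambda i d (e (- (h%:~R / 2 ^+ lambda) : R)).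
Proof.
move=> a01 aout; rewrite /G; congr (_ * _); apply: eq_bigr => u _.
rewrite (fsum_b_shift a L r (fun l => s_trunc lambda (u + l * d + i l))) //.
rewrite eD e_half_subz -eMn; congr (_ * e _); last by rewrite mulNr mulrAC.
congr (_ ^+ _); rewrite addnC -big_split; apply: eq_bigr => l _.
by rewrite /= mulnDr.
Qed.

Lemma normc_G {R : realType} (a : int -> int) (L r lambda d : nat)
    (i : nat -> nat) (h : int) :
  (forall l : nat, (l < L)%N -> a l = (a l == 1)%:Z) ->
  (forall l : int, ~~ (0 <= l < L%:Z) -> a l = 0) ->
  Normc.normc (G lambda i (b_shift a r) h d) = (2 ^+ lambda)^-1 *
    Normc.normc (thue_sum L r (fun l => a l == 1) lambda i d
                   (e (- (h%:~R / 2 ^+ lambda) : R))).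
Proof.
move=> a01 aout; rewrite (G_thue_sum a L) // Normc.normcM Normc.normcV normcX.
by rewrite (normcMn (1 : Rcomplex R)) Normc.normc1.
Qed.

(** * Choice of parameters and final estimate *)

Lemma le_slope1 (i : nat -> nat) (N a b : nat) :
  (forall l : nat, (l < N)%N -> 0 <= (i l.+1)%:Z - (i l)%:Z <= 1) ->
  (a + b <= N)%N -> (i a <= i (a + b) <= i a + b)%N.
Proof.
move=> H; elim: b => [|b IH] abN; first by rewrite !addn0 leqnn.
by have := IH ltac:(lia); have := H (a + b)%N ltac:(lia); rewrite addnS; lia.
Qed.

Lemma gain_ratio_bounds {R : realType} (k : nat) : (0 < k)%N ->
  0 < (gain_ratio k : R) < 1.
Proof.
move=> k0; rewrite /gain_ratio subr_gt0 ltrBlDr ltrDl invr_gt0 exprn_gt0 // andbT.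
by rewrite invf_lt1 ?exprn_gt0 // -natrX ltr1n -(expn0 2) ltn_exp2l // muln_gt0.
Qed.

(** As [rho < 1] and [N >= lambda / K], the power is at most [rho] to the exponent [lambda / K],
    rewritten in base 2. *)
Lemma expr_le_powR2 {R : realType} (rho : R) (K N lambda : nat) :
  0 < rho < 1 -> (0 < K)%N -> (lambda <= K * N)%N ->
  rho ^+ N <= 2 `^ (- (- ln rho / (K%:R * ln 2)) * lambda%:R).
Proof.
move=> /andP[r0 r1] K0 lKN.
have l2 : 0 < ln (2 : R) by rewrite ln_gt0 // ltr1n.
have KR : 0 < K%:R :> R by rewrite ltr0n.
rewrite /powR ifF; last by apply/negbTE; rewrite pnatr_eq0.
rewrite -{1}(lnK r0) -expRM_natl ler_expR.
rewrite (_ : _ * ln 2 = ln rho * (lambda%:R / K%:R)); last first.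
  by field; rewrite !gt_eqF.
rewrite [leLHS]mulrC ler_nM2l; last by rewrite ln_lt0 // r0 r1.
by rewrite ler_pdivrMr // mulrC -natrM ler_nat.
Qed.

Theorem proposition2p7 (R : realType) (L m : nat) (a : int -> int)
  (hL : (1 <= L)%N)
  (hm : (5 <= m)%N)
  (hLm : (2 ^ (m - 5) <= L < 2 ^ (m - 4))%N)
  (a0 : a 0 = 1)
  (a01 : forall l : int, 1 <= l <= L%:Z - 1 -> a l = 0 \/ a l = 1)
  (aout : forall l : int, ~~ (0 <= l < L%:Z) -> a l = 0) :
  exists eta C : R, 0 < eta /\
    forall (lambda r : nat) (i : nat -> nat),
      (1 <= r)%N ->
      (2 * m <= logn 2 r)%N ->
      (logn 2 r)%:R <= lambda%:R / 4 :> R ->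
      i 0%N = 0%N ->
      (forall l : nat, (l < L + r - 1)%N ->
         0 <= (i l.+1)%:Z - (i l)%:Z <= 1) ->
      (2 ^+ lambda)^-1 *
        \sum_(0 <= d < (2 ^ lambda)%N)
          \big[Num.max/0]_(0 <= h < (2 ^ lambda)%N)
            (Normc.normc (G lambda i (b_shift a r) h%:Z d)) ^+ 2
      <= C * 2 `^ (- eta * lambda%:R).
Proof.
set p := (m - 4)%N; set k := (2 * p + 2)%N.
have k0 : (0 < k)%N by rewrite /k; lia.
have Lp : (L < 2 ^ p)%N by case/andP: hLm.
have := @gain_ratio_bounds R k k0; set rho := gain_ratio k => rho01.
(* The average found below is [rho ^+ (n * J)], with [lambda <= 8 * k * (n * J)]; [rho] and [k]
   depend only on [m]. *)
exists (- ln rho / ((8 * k)%N%:R * ln 2)), 1; split.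
  rewrite divr_gt0 ?oppr_gt0 ?ln_lt0 // mulr_gt0 ?ltr0n ?muln_gt0 //.
  by rewrite ln_gt0 // ltr1n.
move=> lambda r i r1 mnu nul i0 iS.
have abool (l : nat) : (l < L)%N -> a l = (a l == 1)%:Z.
  case: l => [|l] lL; first by rewrite a0 eqxx.
  by have [|->|->] := a01 l.+1; [lia | |].
have adm : admissible L r (i r) i.
  move=> l lL; have := le_slope1 _ _ 0 l iS ltac:(lia).
  have := le_slope1 _ _ r l iS ltac:(lia).
  by rewrite i0 !add0n; lia.
set nu := logn 2 r in mnu nul.
have nu4 : (4 * nu <= lambda)%N.
  by rewrite -(ler_nat R) natrM mulrC -ler_pdivlMr // ltr0n.
have [q oq rE] : exists2 q, odd q & r = (2 ^ nu * q)%N.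
  have [q co E] := pfactor_coprime (isT : prime 2) r1.
  by exists q; rewrite -?coprime2n // mulnC.
set J := (nu %/ k)%N; set n := (lambda %/ (nu + nu))%N.
set mu := (lambda %% (nu + nu))%N.
have kJ : (k * J <= nu)%N by rewrite mulnC leq_divM.
have lE : lambda = (n * (nu + nu) + mu)%N by apply: divn_eq.
(* Each floor costs at most a factor 2, as [k <= nu] and [2 * nu <= lambda]; a further 2 is the
   block length [nu + nu]. *)
have NE : (lambda <= 8 * k * (n * J))%N.
  have kn : (k <= nu)%N by rewrite /k; lia.
  have := ltn_ceil nu k0; rewrite -/J => J1.
  have nn0 : (0 < nu + nu)%N by lia.
  have := ltn_pmod lambda nn0; rewrite -/mu => mu1.
  have J2 : (nu <= 2 * k * J)%N.
    have kkJ : (k <= k * J)%N.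
      by rewrite leq_pmulr // lt0n; apply: contraTneq J1 => ->; rewrite -leqNgt mul1n.
    by move: J1 kkJ; rewrite mulSn -mulnA [(J * k)%N]mulnC; move: (k * J)%N => Y; lia.
  have n2 : (lambda <= 4 * n * nu)%N.
    by move: lE mu1; rewrite mulnDr -mulnA; move: (n * nu)%N => X; lia.
  apply: leq_trans n2 _.
  by rewrite (_ : 8 * k * (n * J) = 4 * n * (2 * k * J))%N ?leq_mul2l ?J2 ?orbT //; ring.
rewrite mul1r; apply: le_trans (expr_le_powR2 _ _ _ _ rho01 _ NE); last first.
  by rewrite muln_gt0.
rewrite mulrC ler_pdivrMr ?exprn_gt0 // [leRHS]mulrC.
have := @sum_block_bound R p k q nu J mu n (i r) _ oq kJ.
rewrite -rE -lE => <-; last by rewrite /k; lia.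
(* The right side is now the sum of the block bounds, so it suffices to compare for each [d]. *)
apply: ler_sum => d _.
have nG (B : R) : thue_bound L r (fun l => a l == 1) lambda (i r) d B ->
    forall h : int, Normc.normc (G lambda i (b_shift a r) h d) <= B.
  move=> HB h; rewrite (normc_G a L) // mulrC ler_pdivrMr ?exprn_gt0 // [leRHS]mulrC.
  by apply: HB => //; apply: normc_e.
have GB : thue_bound L r (fun l => a l == 1) lambda (i r) d
    (block_bound p k r nu J n (i r) d : R).
  rewrite {1}lE; apply: thue_bound_blocks => //; first by rewrite a0.
  by rewrite rE dvdn_mulr.
have G1 := nG _ (thue_bound1 L r _ lambda (i r) d).
have {}GB := nG _ GB.
apply: bigmax_le => [|h _]; first exact: le_trans (normc_ge0 _) (GB 0).
(* The modulus of [G] is at most 1, so its square is at most the modulus itself. *)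
by apply: le_trans (GB h); rewrite expr2 ler_piMr ?normc_ge0.
Qed.
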